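(* Let $R$ be the root system of type $A_{n-1}$ and let $(\gamma,J)$ be a placed ribbon shape such that $\gamma$ is dominant and integral (i.e. $\gamma=(\gamma_1,\dots,\gamma_n)$ with $\gamma_1\le\dots\le\gamma_n$ and $\gamma_i\in\mathbb{Z}$). Then the configuration of boxes corresponding to $(\gamma,J)$ is a placed border strip.
   Context: Type $A_{n-1}$: $\{\varepsilon_1,\dots,\varepsilon_n\}$ is an orthonormal basis of $\mathbb{R}^n$, $R=\{\varepsilon_j-\varepsilon_i\mid i\ne j\}$, $R^+=\{\varepsilon_j-\varepsilon_i\mid i<j\}$. For dominant $\gamma=\sum\gamma_i\varepsilon_i$: $Z(\gamma)=\{\alpha\in R^+\mid\langle\gamma,\alpha\rangle=0\}$, $P(\gamma)=\{\alpha\in R\mid\langle\gamma,\alpha\rangle=1\}$. A placed shape is a pair $(\gamma,J)$ with $\gamma$ dominant and $J\subseteq P(\gamma)$; it is a placed ribbon shape if $Z(\gamma)=\emptyset$, i.e. $\langle\gamma,\alpha\rangle\neq0$ for all $\alpha\in R$. Placed configuration of $(\gamma,J)$: boxes $\mathrm{box}_1,\dots,\mathrm{box}_n$ on infinite graph paper whose diagonals run northwest to southeast and are indexed by $\mathbb{Z}$ increasing from southwest to northeast; $\mathrm{box}_i$ is on diagonal $\gamma_i$; boxes on the same diagonal have indices increasing from northwest to southeast; if $\varepsilon_j-\varepsilon_i\in J$ then $\mathrm{box}_j$ is northwest (strictly north, weakly west) of $\mathrm{box}_i$, and if $\varepsilon_j-\varepsilon_i\in P(\gamma)\setminus J$ then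 $\mathrm{box}_j$ is southeast (weakly south, strictly east) of $\mathrm{box}_i$. Boxes are allowed to slide along their diagonals as long as these relative positions are preserved. A border strip (ribbon) is a skew shape $\lambda/\mu$ (the boxes of a partition $\lambda$ not in a partition $\mu\subseteq\lambda$), not necessarily connected, containing at most one box in each diagonal. The configuration is a placed border strip if it can be realized by a border strip placed on the graph paper (the box in row $r$, column $c$, rows numbered downward, lying on the diagonal with index $c-r+\text{const}$), i.e. if there is a placed border strip whose boxes, numbered from southwest to northeast, have diagonal indices $(\gamma_1,\dots,\gamma_n)$ and satisfy $J=\{\varepsilon_j-\varepsilon_i\mid j>i,\ \gamma_j=\gamma_i+1,\ \mathrm{box}_j\text{ is northwest of }\mathrm{box}_i\}$. *)

(* Defs.v *)
From HB Require Import structures.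
From mathcomp Require Import all_boot all_order all_algebra.
From mathcomp Require Import all_classical all_reals.
Set Implicit Arguments.
Unset Strict Implicit.
Unset Printing Implicit Defensive.
Import Order.TTheory GRing.Theory Num.Theory.
Local Open Scope classical_set_scope.
Local Open Scope ring_scope.

Definition dot (R : realType) (n : nat) (u v : 'rV[R]_n) : R :=
  \sum_(k < n) u 0 k * v 0 k.

Definition eps (R : realType) (n : nat) (i : 'I_n) : 'rV[R]_n := delta_mx 0 i.

Definition rootA (R : realType) (n : nat) (j i : 'I_n) : 'rV[R]_n :=
  eps R j - eps R i.

Definition roots (R : realType) (n : nat) : set 'rV[R]_n :=
  [set a | exists i j : 'I_n, i <> j /\ a = rootA R j i].

Definition positive_roots (R : realType) (n : nat) : set 'rV[R]_n :=
  [set a | exists i j : 'I_n, (i < j)%N /\ a = rootA R j i].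

Definition dominant (R : realType) (n : nat) (gamma : 'rV[R]_n) : Prop :=
  forall i j : 'I_n, (i <= j)%N -> gamma 0 i <= gamma 0 j.

Definition integral_weight (R : realType) (n : nat) (gamma : 'rV[R]_n) : Prop :=
  forall i : 'I_n, gamma 0 i \is a Num.int.

Definition Zset (R : realType) (n : nat) (gamma : 'rV[R]_n) : set 'rV[R]_n :=
  [set a | @positive_roots R n a /\ dot gamma a = 0].

Definition Pset (R : realType) (n : nat) (gamma : 'rV[R]_n) : set 'rV[R]_n :=
  [set a | @roots R n a /\ dot gamma a = 1].

Definition placed_shape (R : realType) (n : nat)
    (gamma : 'rV[R]_n) (J : set 'rV[R]_n) : Prop :=
  dominant gamma /\ J `<=` Pset gamma.

Definition placed_ribbon_shape (R : realType) (n : nat)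
    (gamma : 'rV[R]_n) (J : set 'rV[R]_n) : Prop :=
  placed_shape gamma J /\ Zset gamma = set0.

(* A cell of the infinite graph paper is a pair (row, column), with rows
   numbered downward and columns rightward. *)
Definition cell : Type := (int * int)%type.

Definition diag (b : cell) : int := b.2 - b.1.

(* [northwest b b'] reads: b is northwest of b'; likewise for [southeast]. *)
Definition northwest (b b' : cell) : Prop := b.1 < b'.1 /\ b.2 <= b'.2.

Definition southeast (b b' : cell) : Prop := b'.1 <= b.1 /\ b'.2 < b.2.

Definition placed_configuration (R : realType) (n : nat)
    (gamma : 'rV[R]_n) (J : set 'rV[R]_n) (box : 'I_n -> cell) : Prop :=
  [/\ forall i, (diag (box i))%:~R = gamma 0 i,
      forall i j : 'I_n, (i < j)%N -> diag (box i) = diag (box j) ->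
        (box i).1 < (box j).1 /\ (box i).2 < (box j).2,
      forall i j : 'I_n, J (rootA R j i) -> northwest (box j) (box i)
    & forall i j : 'I_n, (Pset gamma `\` J) (rootA R j i) ->
        southeast (box j) (box i)].

Definition is_partition (la : seq nat) : bool :=
  sorted geq la && (0%N \notin la).

Definition subpartition (mu la : seq nat) : Prop :=
  forall r : nat, (nth 0 mu r <= nth 0 la r)%N.

(* Rows and columns are counted from 0. *)
Definition skew_diagram (la mu : seq nat) : set cell :=
  [set b | exists r c : nat,
     (nth 0 mu r <= c < nth 0 la r)%N /\ b = (r%:Z, c%:Z)].

Definition border_strip (la mu : seq nat) : Prop :=
  [/\ is_partition la, is_partition mu, subpartition mu la
    & {in skew_diagram la mu &, injective diag}].

(* The border strip translated by (x, y): its box in row r and column c lies on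
   the diagonal of index c - r + (y - x). *)
Definition placed_border_strip (S : set cell) : Prop :=
  exists (la mu : seq nat) (x y : int),
    border_strip la mu /\
    S = [set (b.1 + x, b.2 + y) | b in skew_diagram la mu].

Definition numbered_sw_to_ne (n : nat) (S : set cell) (box : 'I_n -> cell) :
    Prop :=
  set_bij [set: 'I_n] S box /\
  forall i j : 'I_n, (i < j)%N ->
    (box j).1 <= (box i).1 /\ (box i).2 <= (box j).2.

Definition is_placed_border_strip (R : realType) (n : nat)
    (gamma : 'rV[R]_n) (J : set 'rV[R]_n) : Prop :=
  exists (S : set cell) (box : 'I_n -> cell),
    [/\ placed_border_strip S,
        numbered_sw_to_ne S box,
        placed_configuration gamma J box
      & J = [set a | exists i j : 'I_n,
               [/\ (i < j)%N, gamma 0 j = gamma 0 i + 1,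
                   northwest (box j) (box i) & a = rootA R j i]]].

(* Main.v *)
Require Import Defs.
From mathcomp Require Import all_boot all_order all_algebra.
From mathcomp Require Import all_classical all_reals.
From mathcomp Require Import zify.
Import Order.TTheory GRing.Theory Num.Theory.
Local Open Scope classical_set_scope.
Local Open Scope ring_scope.

(** As [Z(gamma)] is empty, the integers [gamma_i] strictly increase, so
    [box_(i+1)] and [box_i] are related by [J] only if
    [gamma_(i+1) = gamma_i + 1]. Going from southwest to northeast, put
    [box_(i+1)] in the row of [box_i] if [gamma_(i+1) = gamma_i + 1] and the
    root is not in [J], and in the row just above otherwise. The column forced
    by the diagonal is then weakly increasing, and increases by exactly one
    along a row. Such a walk fills every row it crosses with an interval, and
    appending boxes one at a time builds the partitions [la] and [mu] from their
    last part to their first. *)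

Definition translated_skew (la mu : seq nat) (x y : int) : set cell :=
  [set (b.1 + x, b.2 + y) | b in skew_diagram la mu].

Lemma translated_skewP la mu x y p : translated_skew la mu x y p <->
  exists r c : nat,
    (nth 0 mu r <= c < nth 0 la r)%N /\ p = (r%:Z + x, c%:Z + y).
Proof.
split=> [[_ [r [c [h ->]]] <-]|[r [c [h ->]]]]; first by exists r, c.
by exists (r%:Z, c%:Z) => //; exists r, c.
Qed.

(** The first parts describe the top row; removing it moves the row numbers of the others up by one,
    which the shift [x + 1] makes up for. *)
Lemma translated_skew_cons l la m mu x y :
  translated_skew (l :: la) (m :: mu) x y =
  [set (x, c%:Z + y) | c in [set c : nat | (m <= c < l)%N]]
    `|` translated_skew la mu (x + 1) y.
Proof.
apply/seteqP; split=> p.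
  move=> /translated_skewP[[|r] [c [/= h ->]]].
    by left; exists c => //; rewrite add0r.
  right; apply/translated_skewP; exists r, c; split=> //.
  by congr (_, _); lia.
case=> [[c h <-]|/translated_skewP[r [c [h ->]]]]; apply/translated_skewP.
  by exists 0%N, c; rewrite add0r.
by exists r.+1, c; split=> //; congr (_, _); lia.
Qed.

(** For [d = 0] the new box is directly above the old one; a positive [d] starts a new connected
    component. *)
Definition ribbon_step (b b' : cell) : Prop :=
  b' = (b.1, b.2 + 1) \/ exists d : nat, b' = (b.1 - 1, b.2 + d%:Z).

Lemma image_leqS (f : nat -> cell) n :
  [set f k | k in [set k : nat | (k <= n.+1)%N]] =
  [set f k | k in [set k : nat | (k <= n)%N]] `|` [set f n.+1].
Proof.
apply/seteqP; split=> p.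
  move=> [k /= hk <-]; move: hk; rewrite leq_eqVlt => /predU1P[->|hk].
    by right.
  by left; exists k.
by case=> [[k /= hk <-]|->]; [exists k => //=; apply: leqW|exists n.+1 => /=].
Qed.

(* The parts of [mu] are kept positive because [is_partition] forbids trailing
   zeros; the first row of the diagram contains the last box of the walk. *)
Lemma ribbon_walk_skew (f : nat -> cell) n :
  (forall k, (k < n)%N -> ribbon_step (f k) (f k.+1)) ->
  exists (l m : nat) (la mu : seq nat) (x y : int),
    [/\ is_partition (l.+1 :: la) /\ is_partition (m :: mu),
        subpartition (m :: mu) (l.+1 :: la),
        (m <= l)%N, f n = (x, l%:Z + y)
      & translated_skew (l.+1 :: la) (m :: mu) x y =
        [set f k | k in [set k : nat | (k <= n)%N]]].
Proof.
elim: n => [_|n IHn hstep].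
  (* The shape [[:: 2] / [:: 1]] has a single box, in column 1, hence the shift by [- 1]. *)
  exists 1%N, 1%N, [::], [::], (f 0%N).1, ((f 0%N).2 - 1); split=> //.
  - by case=> [|[]].
  - by rewrite [LHS]surjective_pairing; congr (_, _); lia.
  rewrite translated_skew_cons; apply/seteqP; split=> p.
    case=> [[c /= hc <-]|/translated_skewP[r [c [/=]]]]; last first.
      by rewrite !nth_nil; lia.
    exists 0%N => //; rewrite [LHS]surjective_pairing; congr (_, _); lia.
  case=> k /=; rewrite leqn0 => /eqP -> <-; left; exists 1%N => //=.
  by rewrite [RHS]surjective_pairing; congr (_, _); lia.
have [k hk|l [m [la [mu [x [y [[hla hmu] hsub hml hfn himg]]]]]]] := IHn.
  by apply: hstep; apply: leqW.
have := hstep n (ltnSn n); rewrite hfn => -[/= hS|[d /= hS]].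
  (* A step to the right lengthens the top row by one box. *)
  exists l.+1, m, la, mu, x, y; split=> //.
  - split=> //; move: hla; rewrite /is_partition /= !inE /=.
    case: la {hsub himg} => //= a la /andP[/andP[hal ->] ->].
    by rewrite !andbT; apply: leq_trans hal _.
  - by case=> [|r]; [apply: leqW; apply: leqW|apply: (hsub r.+1)].
  - exact: leqW.
  - by rewrite hS; congr (_, _); lia.
  rewrite image_leqS -himg !translated_skew_cons [RHS]setUAC.
  congr (_ `|` _); apply/seteqP; split=> p.
    move=> [c /= hc <-]; have [hcl|hcl] := ltnP c l.+1.
      by left; exists c => //=; lia.
    by right; rewrite hS; congr (_, _); lia.
  case=> [[c /= hc <-]|->]; first by exists c => //=; lia.
  by exists l.+1 => /=; [lia|rewrite hS; congr (_, _); lia].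
have hm : (0 < m)%N.
  by case: m hmu {hsub hml himg} => // /andP[_]; rewrite inE eqxx.
(* A step upwards opens a row whose only box is in column [l + d]. The parts stay sorted as
   [m <= l], and the new part of [mu] is positive by [hm]. *)
exists (l + d)%N, (l + d)%N, (l.+1 :: la), (m :: mu), (x - 1), y; split=> //.
- split.
    move: hla; rewrite /is_partition /= !inE /= => /andP[-> ->].
    by rewrite !andbT; lia.
  move: hmu; rewrite /is_partition /= !inE => /andP[-> /negPf->].
  by rewrite orbF andbT; lia.
- by case=> [|r] /=; [lia|apply: hsub].
- by rewrite hS; congr (_, _); lia.
rewrite image_leqS translated_skew_cons subrK himg setUC; congr (_ `|` _).
apply/seteqP; split=> p.
  by move=> [c /= hc <-]; rewrite hS; congr (_, _); lia.
by move=> ->; exists (l + d)%N => /=; [lia|rewrite hS; congr (_, _); lia].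
Qed.

Lemma ribbon_step_monotone (f : nat -> cell) n i j :
  (forall k, (k < n)%N -> ribbon_step (f k) (f k.+1)) -> (i <= j <= n)%N ->
  (f j).1 <= (f i).1 /\ (f i).2 <= (f j).2.
Proof.
move=> hstep; elim: j => [|j IHj] /andP[hij hjn].
  by have -> : i = 0%N by lia.
move: hij; rewrite leq_eqVlt => /predU1P[->//|hij].
have [h1 h2] := IHj ltac:(lia).
by case: (hstep j hjn) => [->|[d ->]] /=; lia.
Qed.

(** The translation changes all diagonal indices by the same constant, so two boxes of the diagram
    on one diagonal come from the same index of the walk. *)
Lemma ribbon_walk_border_strip (f : nat -> cell) n :
  (forall k, (k < n)%N -> ribbon_step (f k) (f k.+1)) ->
  {in [set k : nat | (k <= n)%N] &, injective (diag \o f)} ->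
  placed_border_strip [set f k | k in [set k : nat | (k <= n)%N]].
Proof.
move=> hstep finj.
have [l [m [la [mu [x [y [[hla hmu] hsub _ _ himg]]]]]]] :=
  ribbon_walk_skew f n hstep.
exists (l.+1 :: la), (m :: mu), x, y; split; last by rewrite -himg.
split=> // b b' /set_mem hb /set_mem hb' hbb'.
have walk c : skew_diagram (l.+1 :: la) (m :: mu) c ->
    exists2 k, (k <= n)%N & f k = (c.1 + x, c.2 + y).
  move=> hc.
  have: translated_skew (l.+1 :: la) (m :: mu) x y (c.1 + x, c.2 + y).
    by exists c.
  by rewrite himg => -[k hk hkc]; exists k.
have [k hk hkb] := walk b hb; have [k' hk' hkb'] := walk b' hb'.
have kk' : k = k'.
  apply: finj; rewrite ?inE //= hkb hkb' /diag /=; move: hbb'.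
  by rewrite /diag; lia.
move: hkb'; rewrite -kk' hkb; case: b b' {hb hb' hbb' hkb} => [b1 b2] [b1' b2'].
by move=> [/= e1 e2]; congr (_, _); lia.
Qed.

Lemma dot_rootA (R : realType) n (gamma : 'rV[R]_n) j i :
  dot gamma (rootA R j i) = gamma 0 j - gamma 0 i.
Proof.
have dotE (k : 'I_n) : \sum_(h < n) gamma 0 h * eps R k 0 h = gamma 0 k.
  rewrite (bigD1 k) //= big1 => [|h hk]; rewrite /eps mxE eqxx /=.
    by rewrite eqxx mulr1 addr0.
  by rewrite (negbTE hk) mulr0.
rewrite /dot -(dotE j) -(dotE i) -sumrB; apply: eq_bigr => h _.
by rewrite /rootA !mxE mulrBr.
Qed.

Lemma ribbon_shape_increasing (R : realType) n (gamma : 'rV[R]_n) J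
    (i j : 'I_n) :
  placed_ribbon_shape gamma J -> (i < j)%N -> gamma 0 i < gamma 0 j.
Proof.
move=> [[hdom _] hZ] hij; rewrite lt_neqAle hdom ?andbT 1?ltnW //.
apply/eqP => hg; suff: Zset gamma (rootA R j i) by rewrite hZ.
by split; [exists i, j|rewrite dot_rootA hg subrr].
Qed.

(** This case is separate because a walk [f 0, ..., f n] has at least one box. *)
Lemma is_placed_border_strip0 (R : realType) (gamma : 'rV[R]_0) J :
  placed_ribbon_shape gamma J -> is_placed_border_strip gamma J.
Proof.
move=> [[_ hJ] _].
have noskew : skew_diagram [::] [::] = set0.
  by apply/seteqP; split=> // b [r [c [/=]]]; rewrite nth_nil; lia.
exists set0, (fun=> (0, 0)); split.
- exists [::], [::], 0, 0; split; last by rewrite noskew image_set0.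
  by split=> // b b'; rewrite noskew inE.
- by split; [split; case|case].
- by split; case.
by apply/seteqP; split=> a; [move=> /hJ[[[[]]]]|move=> [[]]].
Qed.

Theorem proposition4p3 (R : realType) (n : nat)
    (gamma : 'rV[R]_n) (J : set 'rV[R]_n)
    (hshape : placed_ribbon_shape gamma J)
    (hint : integral_weight gamma) :
  is_placed_border_strip gamma J.
Proof.
case: n gamma J hshape hint => [|n] gamma J hshape hint.
  exact: is_placed_border_strip0.
have [[_ hJ] _] := hshape.
(* Beyond [n], [inord] returns a default index, so [g] increases only up to [n]. *)
pose g k : int := Num.floor (gamma 0 (inord k)).
have gE (i : 'I_n.+1) : gamma 0 i = (g i)%:~R.
  by rewrite /g inord_val; have := hint i; rewrite intrEfloor => /eqP ->.
have g_lt (i j : 'I_n.+1) : (i < j)%N -> g i < g j.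
  move=> /(ribbon_shape_increasing R n.+1 gamma J i j hshape).
  by rewrite !gE ltr_int.
have g_ltS k : (k < n)%N -> g k < g k.+1.
  move=> hk; have := g_lt (inord k) (inord k.+1).
  by rewrite !inordK //; [apply|apply: leqW].
pose up k := `[< J (rootA R (inord k.+1 : 'I_n.+1) (inord k)) >]
             || (g k.+1 != g k + 1).
(* [h k] counts the rows climbed before box [k]. Rows are numbered downward, so the row is [- h k],
   and the diagonal [g k] forces the column. *)
pose h k : int := (\sum_(i < k) up i)%N%:Z.
have hS k : h k.+1 = h k + (up k : nat)%:Z by rewrite /h big_ord_recr.
pose f k : cell := (- h k, g k - h k).
have diagf k : diag (f k) = g k by rewrite /diag /=; lia.
have hstep k : (k < n)%N -> ribbon_step (f k) (f k.+1).
  move=> /g_ltS hg; rewrite /ribbon_step /f hS /=.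
  case: (boolP (up k)) => [_|]; last first.
    by rewrite negb_or negbK => /andP[_ /eqP ->]; left; congr (_, _); lia.
  (* Climbing one row uses up one unit of the diagonal increase; the rest is nonnegative since [g]
     strictly increases. *)
  right; exists (absz (g k.+1 - g k - 1)%R); congr (_, _); lia.
have finj : {in [set k : nat | (k <= n)%N] &, injective (diag \o f)}.
  move=> k k'; rewrite !inE /= !diagf => hk hk' hg.
  have := g_lt (inord k) (inord k'); have := g_lt (inord k') (inord k).
  by rewrite !inordK // hg ltxx; case: ltngtP => // ? ? ?; exfalso; auto.
(* An index strictly between [i] and [j] would give an integer strictly between [g i] and [g i + 1].
   So only consecutive boxes are compared, and [up] then reduces to membership in [J]. *)
have succ (i j : 'I_n.+1) : gamma 0 j = gamma 0 i + 1 ->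
    [/\ j = i.+1 :> nat, g i.+1 = g i + 1
      & up i = `[< J (rootA R j i) >]].
  rewrite !gE (_ : _ + 1 = (g i + 1)%:~R); last by rewrite intrD.
  move=> /eqP; rewrite eqr_int => /eqP hg.
  have hij : (i < j)%N.
    have [//|/g_lt|/val_inj hij] := ltngtP i j; first by lia.
    by move: hg; rewrite hij; lia.
  have ji : j = i.+1 :> nat.
    apply/eqP; rewrite eqn_leq hij andbT leqNgt; apply/negP => hj.
    have := g_ltS i; have := g_lt (inord i.+1) j.
    rewrite inordK; last by have := ltn_ord j; lia.
    by have := ltn_ord j; lia.
  have gS : g i.+1 = g i + 1 by rewrite -ji.
  split=> //; rewrite /up gS eqxx orbF inord_val.
  by have -> : inord i.+1 = j by rewrite -ji inord_val.
have PsetE (i j : 'I_n.+1) : Pset gamma (rootA R j i) ->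
    gamma 0 j = gamma 0 i + 1.
  by move=> [_]; rewrite dot_rootA => /eqP; rewrite subr_eq addrC => /eqP.
(* When the diagonal grows by one, a climb keeps the column, so box [j] is directly above box [i];
   without a climb it is directly to the right. *)
have nwJ (i j : 'I_n.+1) : J (rootA R j i) -> northwest (f j) (f i).
  move=> hji; have [ji gS upE] := succ _ _ (PsetE _ _ (hJ _ hji)).
  by rewrite /northwest /f /= ji gS hS upE asboolT //=; lia.
have seJ (i j : 'I_n.+1) : gamma 0 j = gamma 0 i + 1 -> ~ J (rootA R j i) ->
    southeast (f j) (f i).
  move=> /succ[ji gS upE] nJ.
  by rewrite /southeast /f /= ji gS hS upE asboolF //=; lia.
exists [set f k | k in [set k : nat | (k <= n)%N]], (fun i : 'I_n.+1 => f i).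
split.
- exact: ribbon_walk_border_strip.
- split.
    split=> [i _|i j _ _ hij|_ [k /= hk <-]].
    + by exists (i : nat) => //=; rewrite -ltnS.
    + by apply/val_inj/finj; rewrite ?inE /= -1?ltnS //= hij.
    + by exists (inord k) => //=; rewrite inordK.
  move=> i j hij; apply: (ribbon_step_monotone f n i j hstep).
  by have := ltn_ord j; lia.
- split=> [i|i j hij|//|i j [hP nJ]].
  + by rewrite diagf gE.
  + by rewrite !diagf => hg; have := g_lt _ _ hij; rewrite hg ltxx.
  + by apply: seJ => //; apply: PsetE.
apply/seteqP; split=> a.
  move=> Ja; have [[i [j [_ aE]]] _] := hJ _ Ja; subst a.
  have gij := PsetE _ _ (hJ _ Ja); exists i, j; split=> //; last exact: nwJ.
  by have [-> _ _] := succ _ _ gij.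
(* A root outside [J] would place box [j] weakly south of box [i], against [h1]. *)
move=> [i [j [_ gij [h1 h2] ->]]]; apply: contrapT => /(seJ _ _ gij).
by move=> [h3 _]; move: h1; rewrite ltNge h3.
Qed.
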